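(* For every Okada half arc-diagram $H$ of rank $N$, both the propagating index set $\mathrm{PropInd}(H)$ and the propagating label set $\mathrm{PropLab}(H)$ are Fibonacci sets of rank $N$.
   Context: Okada half arc-diagram of rank $N$: a partition of $[N]=\{1,\dots,N\}$ into pairs $\{i,j\}$ (full, non-propagating arcs) and singletons $\{i\}$ (propagating half arcs, drawn from node $i$ with a free end), each carrying an integer label, such that it is non-crossing: no two full arcs $\{a,b\},\{c,d\}$ satisfy $a<c<b<d$, and no propagating half arc at $k$ satisfies $a<k<b$ for a full arc $\{a,b\}$. Nesting: a full arc $\{a<b\}$ is nested in a full arc $\{c<d\}$ if $c<a<b<d$; a full arc $\{a<b\}$ is nested in the half arc at $k$ if $k<a$; the half arc at $i$ is nested in the half arc at $k$ if $k<i$. Labels must satisfy: the label of an arc is at least $1$, at most the smallest node of the arc, and has the same parity as this smallest node; an arc nested in another has a strictly larger label. $\mathrm{PropInd}(H)\subseteq[N]$ is the set of nodes of the propagating half arcs of $H$, and $\mathrm{PropLab}(H)\subseteq[N]$ is the set of their labels. A Fibonacci set of rank $N$ is a subset $S=\{s_1<\dots<s_k\}$ of $[N]$ such that $k\equiv N \pmod 2$ and $s_i\equiv i\pmod 2$ for all $i\in\{1,\dots,k\}$. *)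

(* Defs.v *)
From HB Require Import structures.
From mathcomp Require Import all_boot finmap.

Set Implicit Arguments.
Unset Strict Implicit.
Unset Printing Implicit Defensive.

Local Open Scope nat_scope.
Local Open Scope fset_scope.

(* [N] = {1, ..., N} inside 'I_N.+1 = {0, ..., N}, so that the value of an
   ordinal is the number of the node. *)
Definition nodes (N : nat) : {set 'I_N.+1} := [set i : 'I_N.+1 | 1 <= i].

(* nested A B: the arc A is nested in the arc B.  A pair [set a; b] is a full
   arc, a singleton [set k] is a propagating half arc. *)
Inductive nested (N : nat) : {set 'I_N.+1} -> {set 'I_N.+1} -> Prop :=
| nested_full_full (a b c d : 'I_N.+1) :
    c < a -> a < b -> b < d -> nested [set a; b] [set c; d]
| nested_full_half (a b k : 'I_N.+1) :
    k < a -> a < b -> nested [set a; b] [set k]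
| nested_half_half (i k : 'I_N.+1) :
    k < i -> nested [set i] [set k].

(* Only the values of [label] on the members of [arcs] are meaningful. *)
Record okada_half_arc_diagram (N : nat) := OkadaHalfArcDiagram {
  arcs : {set {set 'I_N.+1}};
  label : {set 'I_N.+1} -> nat;
  arcs_partition : partition arcs (nodes N);
  arcs_card : forall A, A \in arcs -> #|A| = 1 \/ #|A| = 2;
  full_noncrossing : forall a b c d : 'I_N.+1,
    [set a; b] \in arcs -> [set c; d] \in arcs -> ~ (a < c /\ c < b /\ b < d);
  half_noncrossing : forall a b k : 'I_N.+1,
    [set a; b] \in arcs -> [set k] \in arcs -> ~ (a < k /\ k < b);
  label_range : forall (A : {set 'I_N.+1}) (m : 'I_N.+1),
    A \in arcs -> m \in A -> (forall x, x \in A -> m <= x) ->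
    1 <= label A <= m;
  label_parity : forall (A : {set 'I_N.+1}) (m : 'I_N.+1),
    A \in arcs -> m \in A -> (forall x, x \in A -> m <= x) ->
    label A = m %[mod 2];
  label_nested : forall A B : {set 'I_N.+1},
    A \in arcs -> B \in arcs -> nested A B -> label B < label A
}.

Definition half_nodes (N : nat) (H : okada_half_arc_diagram N)
    : {set 'I_N.+1} :=
  [set k | [set k] \in arcs H].

Definition prop_ind (N : nat) (H : okada_half_arc_diagram N) : {fset nat} :=
  [fset val k | k in half_nodes H].

Definition prop_lab (N : nat) (H : okada_half_arc_diagram N) : {fset nat} :=
  [fset label H [set k] | k in half_nodes H].

(* The increasing enumeration s_1 < ... < s_k of S is [sort leq S], whose
   entry of index i, counted from 0, is s_(i+1). *)
Definition fibonacci_set (N : nat) (S : {fset nat}) : Prop :=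
  [/\ forall s, s \in S -> 1 <= s <= N,
      #|` S| = N %[mod 2]
    & forall i, i < #|` S| -> nth 0 (sort leq S) i = i.+1 %[mod 2]].

(* Main.v *)
Require Import Defs.
From mathcomp Require Import all_boot order finmap.

(** No full arc passes around a propagating half arc, nor beyond the end of the
    diagram.  So if [c] is a half node, or [c = N.+1], the nodes
    [1, ..., c - 1] split into the full arcs and the half arcs that lie left
    of [c], and a full arc takes up two of them: [c - 1] has the parity of the
    number of half nodes left of [c] ([odd_half_nodes_below]).  For [c = N.+1]
    this is the condition on the cardinality of a Fibonacci set, and for the
    half node [c] of rank [i] it says that [c] has the parity of [i], which is
    the condition on the members of the propagating index set.

    Each half arc is nested in all the half arcs to its left, so the labels of
    the half arcs strictly increase with their nodes ([label_half_mono]); they also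
    have the same parities as their nodes.  Hence the i-th smallest label
    belongs to the i-th half node and has the parity of [i].
    [fibonacci_image] is the common last step for nodes and labels. *)

Set Implicit Arguments.
Unset Strict Implicit.
Unset Printing Implicit Defensive.

Local Open Scope nat_scope.
Local Open Scope fset_scope.

Lemma sorted_enum_ord n (K : {set 'I_n}) :
  sorted (fun j k : 'I_n => j < k) (enum K).
Proof.
rewrite {1}/enum_mem; apply: sorted_filter.
  by move=> y x z; apply: ltn_trans.
by have := iota_ltn_sorted 0 n; rewrite -val_enum_ord sorted_map enumT.
Qed.

Lemma rank_nth_enum n (K : {set 'I_n}) (x0 : 'I_n) i : i < #|K| ->
  #|[set j in K | j < nth x0 (enum K) i]| = i.
Proof.
move=> iK; set k := nth x0 _ i.
have -> : #|[set j in K | j < k]| =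
          count (fun j : nat => j < k) (map val (enum K)).
  rewrite count_map -size_filter cardE; congr size.
  rewrite /enum_mem -filter_predI; apply: eq_filter => j /=.
  by rewrite !inE andbC.
have sz : i < size (map val (enum K)) by rewrite size_map -cardE.
have srt : sorted ltn (map val (enum K)) by rewrite sorted_map sorted_enum_ord.
have := @Order.PreorderTheory.count_lt_nth _ nat 0 _ i srt sz.
by rewrite (nth_map x0) // -cardE.
Qed.

(** A strictly increasing function carries the increasing enumeration of [K]
    to that of its image, so that the i-th element of the image is the value
    at the element of [K] of rank i. *)
Lemma fibonacci_image n N (K : {set 'I_n}) (f : 'I_n -> nat) :
    {in K &, forall j k : 'I_n, j < k -> f j < f k} ->
    {in K, forall k, 1 <= f k <= N} ->
    #|K| = N %[mod 2] ->
    {in K, forall k, f k = #|[set j in K | j < k]|.+1 %[mod 2]} ->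
  fibonacci_set N [fset f k | k in K].
Proof.
move=> f_mono f_range K_card f_par; set S := [fset f k | k in K].
have srt : sorted ltn (map f (enum K)).
  apply: (homo_sorted_in (P := [in K])) (sorted_enum_ord K) => //.
  by apply/allP=> x; rewrite mem_enum.
have [uniq_fK leq_fK] : uniq (map f (enum K)) /\ sorted leq (map f (enum K)).
  by apply/andP; rewrite -ltn_sorted_uniq_leq.
have SfK : perm_eq S (map f (enum K)).
  apply: uniq_perm; rewrite ?fset_uniq // => x.
  apply/imfsetP/mapP => [[k /= kK ->]|[k kK ->]]; exists k => //.
    by rewrite mem_enum.
  by rewrite mem_enum in kK.
have sortS : sort leq S = map f (enum K).
  rewrite -[RHS](sorted_sort leq_trans leq_fK); apply/perm_sortP => //.
  - exact: leq_total.
  - exact: leq_trans.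
  - exact: anti_leq.
have cardS : #|` S| = #|K| by rewrite (perm_size SfK) size_map cardE.
split; rewrite ?cardS //; first by move=> _ /imfsetP[k kK ->]; apply: f_range.
move=> i iK.
have [x0 _] : exists x0, x0 \in K by apply/card_gt0P; apply: leq_ltn_trans iK.
rewrite sortS (nth_map x0) -?cardE // f_par ?rank_nth_enum //.
by rewrite -mem_enum mem_nth // -cardE.
Qed.

Section HalfArcDiagram.

Variables (N : nat) (H : okada_half_arc_diagram N).

Lemma sum_nodes_below c : 0 < c <= N.+1 ->
  \sum_(x in nodes N) (x < c : nat) = c.-1.
Proof.
case/andP=> c0 cN; rewrite -big_mkcondr /=.
under eq_bigl do rewrite inE andbC.
rewrite -(big_geq_mkord 1 N.+1 (fun i => i < c) (fun=> 1)).
by rewrite -(big_nat_widen 1 c N.+1 xpredT) // sum_nat_const_nat muln1 subn1.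
Qed.

Lemma half_node_unshared k (A : {set 'I_N.+1}) :
  k \in half_nodes H -> A \in arcs H -> k \in A -> A = [set k].
Proof.
rewrite inE => kH AH kA; apply/eqP/negPn/negP => neqA.
have /and3P[_ /trivIsetP/(_ _ _ AH kH neqA) + _] := arcs_partition H.
by rewrite disjoints_subset => /subsetP/(_ k kA); rewrite !inE eqxx.
Qed.

(** Summing the indicator of [x < c] arc by arc counts [c - 1] nodes; a full
    arc on one side of [c] contributes 0 or 2. *)
Lemma odd_half_nodes_below c : 0 < c <= N.+1 ->
    (forall a b : 'I_N.+1, [set a; b] \in arcs H -> ~ (a < c <= b)) ->
  odd #|[set j in half_nodes H | j < c]| = odd c.-1.
Proof.
move=> c_range uncut; rewrite -sum_nodes_below //.
have /and3P[/eqP <- triv _] := arcs_partition H.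
rewrite big_trivIset //= (bigID (fun A : {set _} => #|A| == 1)) /= oddD.
have -> : odd (\sum_(A in arcs H | #|A| != 1) \sum_(x in A) (x < c : nat)) =
          false.
  apply/negbTE; elim/big_ind: _ => // [x y ex ey|A /andP[AH A1]].
    by rewrite oddD negb_add (negbTE ex) (negbTE ey).
  have [/eqP|/eqP/cards2P[a [b [neq_ab defA]]]] := arcs_card AH.
    by rewrite (negbTE A1).
  rewrite defA in AH *; rewrite big_setU1 ?inE //= big_set1.
  have [ac|ca] := ltnP a c; have [bc|cb] := ltnP b c => //.
    by case: (uncut a b AH); rewrite ac.
  by case: (uncut b a); rewrite 1?setUC // bc.
rewrite addbF; congr odd.
have -> : \sum_(A in arcs H | #|A| == 1) \sum_(x in A) (x < c : nat) =
          \sum_(A in set1 @: half_nodes H) \sum_(x in A) (x < c : nat).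
  apply: eq_bigl => A; apply/andP/imsetP => [[AH /cards1P[k defA]]|[k kH ->]].
    by exists k; rewrite // inE -defA.
  by rewrite cards1; rewrite inE in kH.
rewrite big_imset /=; last by move=> j k _ _ /set1_inj.
rewrite -sum1_card; under [RHS]eq_bigr => k _ do rewrite big_set1.
rewrite -big_mkcondr /=; by apply: eq_bigl => k; rewrite !inE.
Qed.

(** Non-crossing excludes only arcs strictly around [k]; an arc ending at [k]
    would share a node with the half arc at [k]. *)
Lemma half_node_uncut k (a b : 'I_N.+1) : k \in half_nodes H ->
  [set a; b] \in arcs H -> ~ (a < k <= b).
Proof.
move=> kH abH /andP[ak]; rewrite leq_eqVlt => /orP[/eqP/val_inj kb|kb].
  have := half_node_unshared kH abH; rewrite kb set22 => /(_ isT)/setP/(_ a).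
  by rewrite set21 inE => /esym/eqP eq_ab; rewrite kb eq_ab ltnn in ak.
by rewrite inE in kH; apply: (half_noncrossing abH kH).
Qed.

Lemma half_node_gt0 (k : 'I_N.+1) : k \in half_nodes H -> 0 < k.
Proof.
rewrite inE => kH; have := cover_partition (arcs_partition H) => /setP/(_ k).
have -> : k \in cover (arcs H) by apply/bigcupP; exists [set k]; rewrite ?inE.
by rewrite inE => /esym.
Qed.

Lemma half_node_parity (k : 'I_N.+1) : k \in half_nodes H ->
  k = #|[set j in half_nodes H | j < k]|.+1 %[mod 2].
Proof.
move=> kH; have k0 := half_node_gt0 kH; rewrite !modn2 /=.
rewrite odd_half_nodes_below => [||a b]; first by rewrite -oddS prednK.
  by rewrite k0 ltnW.
exact: half_node_uncut.
Qed.

Lemma card_half_nodes_parity : #|half_nodes H| = N %[mod 2].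
Proof.
have -> : half_nodes H = [set j in half_nodes H | j < N.+1].
  by apply/setP=> j; rewrite inE ltn_ord andbT.
rewrite !modn2 odd_half_nodes_below ?ltnSn // => a b _ /andP[_].
by rewrite leqNgt ltn_ord.
Qed.

Lemma label_half_mono :
  {in half_nodes H &, forall j k : 'I_N.+1,
    j < k -> label H [set j] < label H [set k]}.
Proof.
by move=> j k; rewrite !inE => jH kH jk; apply: label_nested => //; constructor.
Qed.

Lemma label_half_range_parity (k : 'I_N.+1) : k \in half_nodes H ->
  1 <= label H [set k] <= k /\ label H [set k] = k %[mod 2].
Proof.
rewrite inE => kH; have kmin x : x \in [set k] -> k <= x by move/set1P->.
by split; [apply: label_range|apply: label_parity]; rewrite ?set11.
Qed.

End HalfArcDiagram.

Theorem proposition4p7 (N : nat) (H : okada_half_arc_diagram N) :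
  fibonacci_set N (prop_ind H) /\ fibonacci_set N (prop_lab H).
Proof.
have leN (k : 'I_N.+1) : k <= N by rewrite -ltnS.
split; apply: fibonacci_image => //; try exact: card_half_nodes_parity.
- by move=> k kH; rewrite (half_node_gt0 kH) leN.
- exact: half_node_parity.
- exact: label_half_mono.
- move=> k /label_half_range_parity[/andP[-> lk] _].
  exact: leq_trans lk (leN k).
- by move=> k kH; rewrite (label_half_range_parity kH).2 -half_node_parity.
Qed.
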